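(* For $n\ge 2$, the number of $\pi\in S_n$ avoiding both arrow patterns $(12;2\to 3)$ and $(1;1\to 1)$ equals the Gould number $G_{n-2}$.
   Context: Standard cycle form of $\sigma\in S_n$: product of disjoint cycles (fixed points included), each cycle starting with its largest element, cycles listed in increasing order of largest elements. The fundamental bijection $\theta:S_n\to S_n$ erases the parentheses of the standard cycle form to give a one-line permutation. For $\pi\in S_n$, $\hat\pi=\theta^{-1}(\pi)$. An arrow pattern $(\nu;H)$ of size $k$: a string $\nu=a_1\dots a_m$ of positive integers and a set $H$ of arrows $b\to c$, with all integers appearing forming $[k]$. $\pi\in S_n$ contains $(\nu;H)$ if there is $X=\{x_1<\dots<x_k\}\subseteq[n]$ with positions $t_1<\dots<t_m$ such that $\pi_{t_1}\cdots\pi_{t_m}=x_{a_1}\cdots x_{a_m}$ and $\hat\pi(x_b)=x_c$ for every arrow $b\to c\in H$; otherwise it avoids it. In particular $\pi$ avoids $(1;1\to1)$ iff $\hat\pi$ has no fixed points. The Gould numbers (OEIS A040027: $1,1,3,9,31,121,\dots$) are defined by $G_0=1$ and $G_m=\sum_{k=1}^{m}\binom{m}{k}G_{k-1}$ for $m\ge1$. *)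

(* Defs.v *)
From mathcomp Require Import all_boot.
From mathcomp Require Import fingroup perm.

Set Implicit Arguments.
Unset Strict Implicit.
Unset Printing Implicit Defensive.

(* Conventions.  [n] = {1, ..., n} is represented by 'I_n = {0, ..., n - 1},
   so the values and positions of a permutation, as well as the labels of an
   arrow pattern, are all shifted down by one. *)

Section FundamentalBijection.

Variable n : nat.
Implicit Types s t pi : 'S_n.

Definition one_line pi : seq 'I_n := [seq pi i | i <- enum 'I_n].

Definition cycle_max s (m : 'I_n) := all (fun j : 'I_n => j <= m) (orbit s m).

(* [orbit s m] is the cycle m, s m, s (s m), ... and [enum 'I_n] is
   increasing. *)
Definition standard_cycle_form s : seq (seq 'I_n) :=
  [seq orbit s m | m <- enum 'I_n & cycle_max s m].

Definition theta_word s : seq 'I_n := flatten (standard_cycle_form s).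

Lemma cycle_max_exists s i : exists2 m, cycle_max s m & i \in orbit s m.
Proof.
have si := @perm_inj _ s.
case: (arg_maxnP (P := [in orbit s i]) val (in_orbit s i)) => m im mmax.
have mi : i \in orbit s m.
  by rewrite -fconnect_orbit fconnect_sym ?fconnect_orbit.
exists m => //; apply/allP => j; rewrite -fconnect_orbit => mj.
apply: mmax; rewrite /= -fconnect_orbit.
by apply: connect_trans mj; rewrite fconnect_orbit.
Qed.

Lemma mem_theta_word s i : i \in theta_word s.
Proof.
have [m mm im] := cycle_max_exists s i.
apply/flattenP; exists (orbit s m) => //.
by apply/mapP; exists m; rewrite // mem_filter mm mem_enum.
Qed.

Lemma theta_word_uniq s : uniq (theta_word s).
Proof.
have si := @perm_inj _ s.
rewrite /theta_word /standard_cycle_form.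
have : uniq [seq m <- enum 'I_n | cycle_max s m].
  by rewrite filter_uniq ?enum_uniq.
have : all (cycle_max s) [seq m <- enum 'I_n | cycle_max s m].
  by apply: filter_all.
elim: [seq _ <- _ | _] => //= m ms IH /andP[mm msm] /andP[mNms ums].
rewrite cat_uniq orbit_uniq IH // andbT /=.
apply/hasPn => j /flattenP[_ /mapP[m' m'ms ->] jm'].
apply: contra mNms => jm.
have [jM jM'] : fconnect s m j /\ fconnect s m' j by rewrite !fconnect_orbit.
have mm' : fconnect s m m'.
  by apply: connect_trans jM _; rewrite fconnect_sym.
have m'm : fconnect s m' m by rewrite fconnect_sym.
suff -> : m = m' by [].
apply/val_inj/eqP; rewrite eqn_leq.
rewrite (allP mm) -?fconnect_orbit // andbT.
by rewrite (allP (allP msm _ m'ms)) // -fconnect_orbit.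
Qed.

Lemma size_theta_word s : size (theta_word s) = n.
Proof.
rewrite -(card_uniqP (theta_word_uniq s)) -[RHS]card_ord.
by apply: eq_card => i; rewrite mem_theta_word.
Qed.

Definition theta_fun s (i : 'I_n) : 'I_n := nth i (theta_word s) i.

Lemma theta_fun_inj s : injective (theta_fun s).
Proof.
move=> i j; rewrite /theta_fun (set_nth_default j) ?size_theta_word // => /eqP.
by rewrite nth_uniq ?size_theta_word ?theta_word_uniq // => /eqP/val_inj.
Qed.

Definition theta s : 'S_n := perm (@theta_fun_inj s).

Lemma one_line_theta s : one_line (theta s) = theta_word s.
Proof.
rewrite /one_line; case E: (enum 'I_n) => [|x0 e].
  apply/esym/nilP.
  by rewrite /nilp size_theta_word -[X in X == _]card_ord cardE E.
rewrite -E; apply: (@eq_from_nth _ x0) => [|i].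
  by rewrite size_map size_enum_ord size_theta_word.
rewrite size_map size_enum_ord => ltin.
rewrite (nth_map x0) ?size_enum_ord // permE /theta_fun nth_enum_ord //.
by apply: set_nth_default; rewrite size_theta_word.
Qed.

(* A sequence of blocks with increasing heads, each the strict maximum of its
   block, is determined by its concatenation. *)
Definition std_blocks (bs : seq (seq 'I_n)) :=
  all (fun b : seq 'I_n => if b is m :: r then all (fun j : 'I_n => j < m) r else false) bs
  && pairwise (fun b c : seq 'I_n =>
       if (b, c) is (m :: _, m' :: _) then m < m' else false) bs.

Lemma std_blocks_flatten_inj bs cs :
  std_blocks bs -> std_blocks cs -> flatten bs = flatten cs -> bs = cs.
Proof.
have aux (m : 'I_n) r (bs' : seq (seq 'I_n)) (m' : 'I_n) r' cs' :
    std_blocks ((m :: r) :: bs') -> std_blocks ((m' :: r') :: cs') -> m = m' ->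
    r ++ flatten bs' = r' ++ flatten cs' -> size r <= size r' -> r = r'.
  move=> /andP[/= /andP[_ ok] /andP[inc _]] /andP[/= /andP[r'm _] _] mm' e le.
  have er : take (size r) r' = r.
    by have := congr1 (take (size r)) e; rewrite take_size_cat // takel_cat.
  have ed : flatten bs' = drop (size r) r' ++ flatten cs'.
    move: e; rewrite -{1}(cat_take_drop (size r) r') er -catA.
    by move/eqP; rewrite eqseq_cat // eqxx => /eqP.
  case: bs' ok inc {e} ed => [_ _|[//|h b] bs' _ /andP[mh _]] ed.
    rewrite -[RHS](cat_take_drop (size r)) er.
    by case: (drop _ _) ed => //; rewrite cats0.
  case D: (drop (size r) r') ed => [|h' d] ed.
    by rewrite -[RHS](cat_take_drop (size r)) er D cats0.
  case: ed => hh' _.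
  have : h' \in r' by apply: (@mem_drop (size r)); rewrite D mem_head.
  by move/(allP r'm); rewrite -hh' -mm' ltnNge ltnW.
elim: bs cs => [|b bs IH] [|c cs] //.
- by case: c => // m r /andP[].
- by case: b => // m r /andP[].
case: b => [/andP[] //|m r]; case: c => [_ /andP[] //|m' r'] okb okc /= [mm' e].
have rr' : r = r'.
  case/orP: (leq_total (size r) (size r')) => le.
    exact: aux okb okc mm' e le.
  by apply/esym; apply: aux okc okb (esym mm') (esym e) le.
move: e; rewrite mm' rr' => /eqP; rewrite eqseq_cat // eqxx => /eqP e.
rewrite (IH cs) //.
  by case/andP: okb => /= /andP[_ ?] /andP[_ ?]; apply/andP.
by case/andP: okc => /= /andP[_ ?] /andP[_ ?]; apply/andP.
Qed.

Lemma standard_cycle_formP s : std_blocks (standard_cycle_form s).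
Proof.
have orbE m : orbit s m = m :: behead (orbit s m).
  by rewrite /orbit; have := fingraph.order_gt0 s m; case: (fingraph.order s m).
apply/andP; split.
  apply/allP => _ /mapP[m mm ->].
  move: mm; rewrite mem_filter => /andP[mm _].
  have := orbit_uniq s m; move: mm; rewrite /cycle_max orbE /=.
  move=> /andP[_ mm] /andP[mN _]; apply/allP => j jr.
  rewrite ltn_neqAle (allP mm) // andbT; apply: contra mN => /eqP/val_inj jm.
  by rewrite -[X in X \in _]jm.
rewrite /standard_cycle_form pairwise_map.
have E : pairwise (fun i j : 'I_n => i < j) (enum 'I_n).
  have := iota_ltn_sorted 0 n.
  rewrite sorted_pairwise; last exact: ltn_trans.
  by rewrite -val_enum_ord pairwise_map.
apply: sub_pairwise (pairwise_filter _ E) => i j /=.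
by rewrite (orbE i) (orbE j).
Qed.

Lemma theta_inj : injective theta.
Proof.
move=> s t /(congr1 one_line); rewrite !one_line_theta => e.
have {}e : standard_cycle_form s = standard_cycle_form t.
  apply: std_blocks_flatten_inj e; exact: standard_cycle_formP.
apply/permP => i.
have := mem_theta_word s i => /flattenP[b bs ib].
have fc u : b \in standard_cycle_form u -> u i = next b i.
  case/mapP => m _ bE; apply/eqP.
  by apply: (@next_cycle _ (frel u)) => //; rewrite bE cycle_orbit //; exact: perm_inj.
by rewrite (fc s) // (fc t) // -e.
Qed.

Definition hat pi : 'S_n := invF theta_inj pi.

End FundamentalBijection.

(* [(w; H)] with labels in [k]; the last field says that every label occurs. *)
Record arrow_pattern := ArrowPattern {
  ap_size : nat;
  ap_word : seq 'I_ap_size;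
  ap_arrows : {set 'I_ap_size * 'I_ap_size};
  _ : [forall a, (a \in ap_word)
                 || [exists h in ap_arrows, (h.1 == a) || (h.2 == a)]]
}.

(* [x] enumerates X increasingly; [t] is the list of positions. *)
Definition contains n (pi : 'S_n) (p : arrow_pattern) : bool :=
  [exists x : {ffun 'I_(ap_size p) -> 'I_n},
   exists t : (size (ap_word p)).-tuple 'I_n,
    [&& [forall a : 'I_(ap_size p), forall b : 'I_(ap_size p),
         (a < b) ==> (x a < x b)],
        sorted (fun i j : 'I_n => i < j) t,
        [seq pi i | i <- t] == [seq x a | a <- ap_word p] &
        [forall h in ap_arrows p, hat pi (x h.1) == x h.2]]].

Definition avoids n (pi : 'S_n) (p : arrow_pattern) : bool := ~~ contains pi p.

(* The labels 1, 2, 3 of a pattern of size 3, and 1 of a pattern of size 1. *)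
Definition lab1 : 'I_3 := @Ordinal 3 0 isT.
Definition lab2 : 'I_3 := @Ordinal 3 1 isT.
Definition lab3 : 'I_3 := @Ordinal 3 2 isT.
Definition lab1' : 'I_1 := @Ordinal 1 0 isT.

Lemma pat_12_2to3_subproof :
  [forall a, (a \in [:: lab1; lab2])
             || [exists h in [set (lab2, lab3)], (h.1 == a) || (h.2 == a)]].
Proof.
apply/forallP => -[[|[|[|//]]] i] //=.
by apply/existsP; exists (lab2, lab3); rewrite inE eqxx.
Qed.

(* (12; 2 -> 3) *)
Definition pat_12_2to3 : arrow_pattern :=
  @ArrowPattern 3 [:: lab1; lab2] [set (lab2, lab3)] pat_12_2to3_subproof.

Lemma pat_1_1to1_subproof :
  [forall a, (a \in [:: lab1'])
             || [exists h in [set (lab1', lab1')], (h.1 == a) || (h.2 == a)]].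
Proof. by apply/forallP => -[[|//] i]. Qed.

(* (1; 1 -> 1) *)
Definition pat_1_1to1 : arrow_pattern :=
  @ArrowPattern 1 [:: lab1'] [set (lab1', lab1')] pat_1_1to1_subproof.

(* [:: G_0; ...; G_m] *)
Fixpoint gould_seq (m : nat) : seq nat :=
  if m is m'.+1 then
    rcons (gould_seq m')
      (\sum_(1 <= k < m.+1) 'C(m, k) * nth 0 (gould_seq m') k.-1)
  else [:: 1].

Definition gould (m : nat) : nat := nth 0 (gould_seq m) m.

Lemma gould0 : gould 0 = 1. Proof. by []. Qed.

Lemma size_gould_seq m : size (gould_seq m) = m.+1.
Proof. by elim: m => //= m IH; rewrite size_rcons IH. Qed.

Lemma nth_gould_seq m i : i <= m -> nth 0 (gould_seq m) i = gould i.
Proof.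
elim: m => [|m IH]; first by case: i.
rewrite leq_eqVlt => /orP[/eqP-> //|lt].
by rewrite /= nth_rcons size_gould_seq lt IH.
Qed.

Lemma gouldE m : 0 < m ->
  gould m = \sum_(1 <= k < m.+1) 'C(m, k) * gould k.-1.
Proof.
case: m => // m _.
rewrite {1}/gould /= nth_rcons size_gould_seq ltnn eqxx.
apply: eq_big_nat => -[//|k] /andP[_ le].
by rewrite nth_gould_seq.
Qed.

(* Main.v *)
Require Import Defs.
From mathcomp Require Import all_boot.
From mathcomp Require Import fingroup perm.

Set Implicit Arguments.
Unset Strict Implicit.
Unset Printing Implicit Defensive.

(* Write s = hat pi.  In the one-line word of pi = theta s, a letter y followed
   by z has s y = z inside a cycle; at the end of a cycle, s y is the maximum of
   that cycle and z is a new record.  So, when s has no fixed point, y < s y holds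
   exactly when y is an ascent bottom or the last letter.  Avoiding (12; 2 -> 3)
   says that all these y are left-to-right minima; then absence of fixed points
   amounts to the first two letters not being an ascent.
   Read from right to left, such words start with the minimum, and can be counted
   letter by letter: the number of admissible continuations depends only on how
   many unused letters are above and below the current one, and it satisfies a
   Pascal-type recurrence whose binomial expansion is the Gould recurrence. *)

(** * A Pascal-type recurrence with Gould values *)

(* The number of admissible continuations when a unused letters are above the
   current letter and b are below it (see count_desc_min). *)
Fixpoint nwords (a b : nat) : nat :=
  match a, b with
  | 0, 0 => 1
  | 0, 1 => 0
  | 0, b'.+2 => gould b'
  | a'.+1, 0 => gould a'
  | a'.+1, _ => nwords a' b + nwords a' b.+1
  end.

(** Each unfolding of [a] either keeps the second argument or raises it by one; ['C(a, i)] counts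
    the ways to raise it [i] times. *)
Lemma nwords_binomial a b :
  nwords a b.+1 = \sum_(i < a.+1) 'C(a, i) * nwords 0 (b.+1 + i).
Proof.
elim: a b => [|a IH] b; first by rewrite big_ord1 addn0 mul1n.
rewrite -[LHS]/(nwords a b.+1 + nwords a b.+2) !IH big_ord_recl [RHS]big_ord_recl.
rewrite !bin0 -addnA; congr (_ + _).
rewrite [X in _ + X](eq_bigr (fun i : 'I_a.+1 => 'C(a, i) * nwords 0 (b.+1 + i.+1))).
  2: by move=> i _; rewrite addSnnS.
rewrite [X in X + _](_ : _ = \sum_(i < a.+1) 'C(a, i.+1) * nwords 0 (b.+1 + i.+1)).
  2: by rewrite [RHS]big_ord_recr /= bin_small // addn0.
rewrite -big_split; apply: eq_bigr => i _.
by rewrite binS mulnDl.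
Qed.

(** The term [i = 0] vanishes because [nwords 0 1 = 0]; the others form the Gould recurrence. *)
Lemma nwords1 a : nwords a.+1 1 = gould a.+1.
Proof.
rewrite nwords_binomial gouldE // big_ord_recl muln0 add0n.
by rewrite big_add1 big_mkord; apply: eq_bigr.
Qed.

Lemma nwords_rec_pos a b : nwords a b.+1 =
  \sum_(i < a) nwords (a - i.+1) (b.+1 + i)
    + (if a + b is c.+1 then gould c else 0).
Proof.
elim: a b => [|a IH] b; first by rewrite big_ord0 add0n; case: b.
rewrite -[LHS]/(nwords a b.+1 + nwords a b.+2) (IH b.+1) addnS addSn big_ord_recl subn1 addn0 -!addnA; congr (_ + (_ + _)).
by apply: eq_bigr => i _; rewrite /bump /= subSS addnCA addnC addSn addnC.
Qed.

(** With nothing below the current letter, only steps up remain. The terms [i > 0] come from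
    [nwords_rec_pos], because [nwords a.+1 1] and [nwords a.+2 0] are both [gould a.+1]. *)
Lemma nwords_rec0 a :
  nwords a.+1 0 = \sum_(i < a.+1) nwords (a.+1 - i.+1) i.
Proof.
rewrite big_ord_recl subn1 /=.
case: a => [|a]; first by rewrite big_ord0.
have := nwords_rec_pos a.+1 0; rewrite nwords1 addn0 => ->.
by rewrite addnC.
Qed.

(** * Neighbouring letters in the one-line word *)

Lemma enum_ord_pairwise n : pairwise (fun i j : 'I_n => i < j) (enum 'I_n).
Proof.
have := iota_ltn_sorted 0 n.
rewrite sorted_pairwise; last exact: ltn_trans.
by rewrite -val_enum_ord pairwise_map.
Qed.

Lemma orbitE n (s : 'S_n) m : orbit s m = m :: behead (orbit s m).
Proof.
by rewrite /orbit; have := fingraph.order_gt0 s m; case: (fingraph.order s m).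
Qed.

(** A letter ending a cycle with maximum [m] has [s y = m], and the next cycle opens with a larger
    maximum. A fixed point is a whole cycle, and all earlier cycles have smaller maxima. The first
    letter is the maximum of its cycle. *)
Lemma theta_word_split_exists n (s : 'S_n) (y : 'I_n) : exists u v,
  [/\ theta_word s = u ++ y :: v,
      if v is z :: _ then (s y == z) || (y <= s y) && (y < z) else y <= s y,
      s y = y -> all (fun j : 'I_n => j < y) u &
      u = [::] -> s y <= y].
Proof.
have [m mm ym] := cycle_max_exists s y.
rewrite /theta_word /standard_cycle_form.
have mE : m \in [seq m <- enum 'I_n | cycle_max s m].
  by rewrite mem_filter mm mem_enum.
have A : all (cycle_max s) [seq m <- enum 'I_n | cycle_max s m] by apply: filter_all.
have : pairwise (fun i j : 'I_n => i < j) [seq m <- enum 'I_n | cycle_max s m].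
  by apply: pairwise_filter; apply: enum_ord_pairwise.
case/splitPr: mE A => ms1 ms2.
rewrite all_cat /= => /and3P[A1 _ A2].
rewrite pairwise_cat allrel_consr /= => /and4P[/andP[lt1 _] _ lt2 _].
have ymax : y <= m by apply: (allP mm).
have cyc : fcycle s (orbit s m) by apply/cycle_orbit/perm_inj.
have uo : uniq (orbit s m) by apply: orbit_uniq.
have hd : head y (orbit s m) = m.
  by rewrite orbitE.
rewrite map_cat flatten_cat /=.
have sym : s y <= m.
  apply: (allP mm); rewrite -fconnect_orbit.
  by apply: connect_trans (fconnect1 _ _); rewrite fconnect_orbit.
have mx : all (fun j : 'I_n => j <= m) (orbit s m) := mm.
move: cyc uo hd mx.
case/splitPr: ym => p q cyc uo hd mx.
exists (flatten [seq orbit s m | m <- ms1] ++ p),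
  (q ++ flatten [seq orbit s m | m <- ms2]).
(* Rotating the cycle to start at [y] makes [s y] the head of [q], or of [p] when [q] is empty. *)
rewrite -(rot_cycle (size p)) rot_size_cat /= in cyc.
split=> //.
- by rewrite -!catA.
- case: q cyc uo hd mx => [|z q] /=; last by case/andP=> /eqP->; rewrite eqxx.
  move=> cyc _ hd _.
  have sy : s y = m.
    by case: p cyc hd => [|z p] /= /andP[/eqP-> _].
  rewrite sy ymax; case: ms2 {A2} lt2 => //= m2 ms2 /andP[lt2 _].
  by rewrite orbitE /= (leq_ltn_trans ymax lt2) orbT.
- move=> sy.
  have q0 : q = [::].
    case: q cyc uo {hd mx} => // z q /= /andP[/eqP syz _].
    by rewrite cat_uniq /= inE -sy syz eqxx !andbF.
  have p0 : p = [::].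
    rewrite q0 in uo cyc hd mx.
    case: p cyc uo hd {mx} => //= z p /andP[/eqP syz _].
    by rewrite mem_cat inE -syz sy eqxx orbT.
  rewrite p0 cats0; apply/allP => j /flattenP[_ /mapP[m' m'1 ->] jm'].
  rewrite p0 /= in hd.
  rewrite hd; apply: leq_ltn_trans (allP lt1 _ m'1).
  by apply: (allP (allP A1 _ m'1)).
- move=> /eqP; rewrite -size_eq0 size_cat addn_eq0 => /andP[_ /nilP p0].
  by rewrite p0 /= in hd; rewrite {2}hd.
Qed.

(** * The two patterns in terms of [hat pi] *)

Lemma theta_hat n (pi : 'S_n) : theta (hat pi) = pi.
Proof. exact: f_invF. Qed.

Lemma contains_1_1to1 n (pi : 'S_n) :
  contains pi pat_1_1to1 = [exists x, hat pi x == x].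
Proof.
apply/existsP/existsP => [[x /existsP[t /and4P[_ _ _ /forallP H]]]|[x xx]].
  by exists (x lab1'); have := H (lab1', lab1'); rewrite /= inE eqxx.
exists [ffun=> x]; apply/existsP; exists [tuple (pi^-1)%g x].
apply/and4P; split=> //=.
- by apply/forallP => -[[|//] ?]; apply/forallP => -[[|//] ?].
- by rewrite ffunE permKV.
- by apply/forall_inP => h _; rewrite !ffunE.
Qed.

Lemma contains_12_2to3 n (pi : 'S_n) :
  contains pi pat_12_2to3 =
  [exists i : 'I_n, exists j : 'I_n,
    [&& i < j, pi i < pi j & pi j < hat pi (pi j)]].
Proof.
apply/existsP/existsP =>
    [[x /existsP[t /and4P[/forallP lt st /eqP E /forallP H]]]|
     [i /existsP[j /and3P[ij pij pijs]]]].
  case: t st E => -[|i [|j []]] //= st; rewrite andbT => ij [pi1 pi2].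
  exists i; apply/existsP; exists j.
  have := H (lab2, lab3); rewrite inE eqxx /= => /eqP h2.
  rewrite ij pi1 pi2 h2 /=.
  have /forallP/(_ lab2) := lt lab1; have /forallP/(_ lab3) := lt lab2.
  by rewrite /= => -> ->.
exists [ffun a : 'I_3 => tnth [tuple pi i; pi j; hat pi (pi j)] a].
apply/existsP; exists [tuple i; j]; apply/and4P; split=> //=.
- apply/forallP => -[[|[|[|//]]] ?]; apply/forallP => -[[|[|[|//]]] ?] //;
    by rewrite !ffunE !(tnth_nth (pi i)) /= ?pij ?pijs // (ltn_trans pij).
- by rewrite ij.
- by rewrite !ffunE !(tnth_nth (pi i)).
- by apply/forall_inP => h; rewrite inE => /eqP->; rewrite !ffunE !(tnth_nth (pi i)).
Qed.

(** Since letters are distinct, the failure of [pi i < pi j] means [pi j < pi i], which makes [pi j]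
    a left-to-right minimum. *)
Lemma avoids_12_2to3 n (pi : 'S_n) : avoids pi pat_12_2to3 =
  pairwise (fun x y : 'I_n => (y < hat pi y) ==> (y < x)) (one_line pi).
Proof.
rewrite /avoids contains_12_2to3 /one_line pairwise_map.
apply/idP/idP => [|H].
  rewrite negb_exists => /forallP H.
  apply: sub_pairwise (enum_ord_pairwise n) => i j ij /=.
  apply/implyP => js; have := H i; rewrite negb_exists => /forallP/(_ j).
  rewrite ij js andbT /= -leqNgt leq_eqVlt => /predU1P[|//].
  by move=> /val_inj/perm_inj ji; rewrite ji ltnn in ij.
apply/negP => /existsP[i /existsP[j /and3P[ij pij pijs]]].
move/pairwiseP: H => /(_ i i j); rewrite !inE -cardE card_ord.
move=> /(_ (ltn_ord i) (ltn_ord j) ij).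
by rewrite !nth_ord_enum /= pijs /= ltnNge ltnW.
Qed.

(** * Avoidance as a condition on the reversed word *)

Lemma uniq_split_inj (T : eqType) (y : T) u v u' v' :
  uniq (u ++ y :: v) -> u ++ y :: v = u' ++ y :: v' -> u = u' /\ v = v'.
Proof.
move=> U E; have U' := U; rewrite E in U'.
have notin (a b : seq T) : uniq (a ++ y :: b) -> y \notin a.
  by rewrite cat_uniq => /and3P[_ /norP[]].
have := congr1 (index y) E; rewrite !index_cat.
rewrite (negbTE (notin _ _ U)) (negbTE (notin _ _ U')) /= eqxx !addn0 => sz; have /eqP := E.
by rewrite eqseq_cat // => /andP[/eqP-> /eqP[->]].
Qed.

Lemma theta_word_split n (s : 'S_n) (y : 'I_n) u v :
  theta_word s = u ++ y :: v ->
  [/\ if v is z :: _ then (s y == z) || (y <= s y) && (y < z) else y <= s y,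
      s y = y -> all (fun j : 'I_n => j < y) u &
      u = [::] -> s y <= y].
Proof.
have [u' [v' [E ? ? ?]]] := theta_word_split_exists s y.
have := theta_word_uniq s; rewrite E => U.
by case/(uniq_split_inj U) => <- <-.
Qed.

(** Brings a pairwise condition to the letter-by-letter form used in [theta_word_split]. *)
Lemma pairwise_splitP (T : Type) (r : rel T) w :
  pairwise r w <-> forall u y v, w = u ++ y :: v -> all (r^~ y) u.
Proof.
split=> [+ u y v E|]; first by rewrite E pairwise_cat allrel_consr => /andP[/andP[]].
elim/last_ind: w => // w x IH H; rewrite -cats1 pairwise_cat allrel1r /= andbT.
rewrite (H w x [::]) ?cats1 //=; apply: IH => u y v E.
by apply: (H u y (rcons v x)); rewrite E -rcons_cons -rcons_cat.
Qed.

(* t is what precedes x in the one-line word, read backwards; the test r != [::]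
   excludes a fixed point in first position. *)
Fixpoint desc_min {n} (x : 'I_n) (t : seq 'I_n) : bool :=
  if t is y :: r then
    ((x < y) || (r != [::]) && all (fun z : 'I_n => y < z) r) && desc_min y r
  else true.

(** In the word [rcons u x] the letter after [y] is [head x u2]; the default [x] covers the case
    where [y] ends [u]. *)
Lemma desc_min_revP n (x : 'I_n) (u : seq 'I_n) :
  reflect (forall u1 y u2, u = u1 ++ y :: u2 -> y <= head x u2 ->
             u1 != [::] /\ all (fun z : 'I_n => y < z) u1)
    (desc_min x (rev u)).
Proof.
elim/last_ind: u x => [|u y IH] x; first by left => -[|? ?].
rewrite rev_rcons /=; apply: (iffP andP) => [[c /IH{}IH] u1 z u2|H].
  case/lastP: u2 => [|u2 z'].
    rewrite cats1 => /rcons_inj[<- <-] /= yx.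
    case/orP: c => [xy|/andP[]].
      by rewrite leqNgt xy in yx.
    by rewrite -size_eq0 size_rev size_eq0 all_rev.
  rewrite -rcons_cons -rcons_cat => /rcons_inj[E <-] zx.
  by apply: (IH u1 z u2) => //; case: u2 zx {E}.
split.
  case: ltnP => //= yx.
  have := H u y [::]; rewrite cats1 => /(_ erefl yx).
  by rewrite -size_eq0 -[_ (rev u) _]size_eq0 size_rev all_rev => -[-> ->].
apply/IH => u1 z u2 E zy; apply: (H u1 z (rcons u2 y)).
  by rewrite E -rcons_cons -rcons_cat.
by case: u2 zy {E}.
Qed.

(** The head of the reversed word is the last letter of the permutation; being a left-to-right
    minimum, it is the overall minimum. *)
Definition good_word {n} (w : seq 'I_n) : bool :=
  if w is x :: t then all (fun y : 'I_n => x < y) t && desc_min x t else false.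

Lemma avoids_good_word n (pi : 'S_n) : 2 <= n ->
  avoids pi pat_12_2to3 && avoids pi pat_1_1to1 = good_word (rev (one_line pi)).
Proof.
move=> n2; rewrite avoids_12_2to3.
rewrite [avoids pi pat_1_1to1]/avoids contains_1_1to1 negb_exists.
have : size (one_line pi) = n by rewrite size_map size_enum_ord.
have : one_line pi = theta_word (hat pi) by rewrite -one_line_theta theta_hat.
case/lastP: (one_line pi) => [|u x] W; first by move=> sz; rewrite -sz in n2.
rewrite size_rcons rev_rcons /= all_rev => sz.
apply/andP/andP => [[/pairwise_splitP PW /forallP NF]|[xu /desc_min_revP D]].
  (* Without fixed points [y <= hat pi y] is strict, so avoidance makes [y] a left-to-right
     minimum. *)
  have exc u1 y v : rcons u x = u1 ++ y :: v -> y <= hat pi y ->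
      y < hat pi y /\ all (fun z : 'I_n => y < z) u1.
    move=> E le; have lt : y < hat pi y by rewrite ltn_neqAle le andbT eq_sym (NF y).
    by split=> //; apply: sub_all (PW _ _ _ E) => z; rewrite lt.
  split.
    have E : rcons u x = u ++ [:: x] by rewrite cats1.
    have [le _ _] := theta_word_split (etrans (esym W) E).
    by have [] := exc _ _ _ E le.
  apply/desc_min_revP => u1 y u2 E0 yx.
  have E : rcons u x = u1 ++ y :: rcons u2 x by rewrite E0 -rcons_cons -rcons_cat.
  have [H _ H0] := theta_word_split (etrans (esym W) E).
  (* Either [hat pi y] is the next letter, which is at least [y], or the bound is given directly. *)
  have le : y <= hat pi y.
    by case: u2 yx H {E0 E} => [|z u2] /= yx /orP[/eqP->|/andP[]].
  have [lt ->] := exc _ _ _ E le; split=> //.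
  by apply/eqP => /H0; rewrite leqNgt lt.
(* In the other direction, [y <= hat pi y] forces the next letter to be at least [y], so [D]
   applies; for the last letter, [2 <= n] makes [u1] nonempty. *)
have C u1 y v : rcons u x = u1 ++ y :: v -> y <= hat pi y ->
    u1 != [::] /\ all (fun z : 'I_n => y < z) u1.
  move=> E le; have [H _ _] := theta_word_split (etrans (esym W) E).
  case/lastP: v E H => [|v z].
    rewrite cats1 => /rcons_inj[<- <-] _; split=> //.
    by rewrite -size_eq0; case: (size u) sz n2 => // <-.
  rewrite -rcons_cons -rcons_cat => /rcons_inj[E <-] H; apply: (D _ _ _ E).
  by case: v H {E} => [|a v] /= /orP[/eqP<-|/andP[_ /ltnW]].
split.
  apply/pairwise_splitP => u1 y v E; case: ltnP => [lt|_]; last by elim: (u1).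
  by have [_] := C _ _ _ E (ltnW lt).
(* A fixed point exceeds every letter before it, whereas [C] puts it below them and provides at
   least one. *)
apply/forallP => y; apply/eqP => yy.
have := mem_theta_word (hat pi) y; rewrite -W => /splitPr E.
case: _ / E W C => u1 v W C.
have [_ /(_ yy) lt _] := theta_word_split (esym W).
have [] := C u1 y v erefl; first by rewrite yy.
by case: u1 lt {W C} => //= a u1 /andP[ay _] _ /andP[]; rewrite ltnNge ltnW.
Qed.

(** * Counting the admissible words *)

Lemma count_permutations (T : eqType) (p : pred (seq T)) (s : seq T) :
  uniq s -> s != [::] ->
  count p (permutations s) =
    \sum_(y <- s) count (fun t => p (y :: t)) (permutations (rem y s)).
Proof.
move=> us s0; rewrite (seq.permP (permutationsE _)) ?lt0n ?size_eq0 // (undup_id us).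
rewrite count_flatten sumnE !big_map; apply: eq_bigr => y _.
by rewrite count_map.
Qed.

Lemma rem_cat_cons (T : eqType) (y : T) u v :
  y \notin u -> rem y (u ++ y :: v) = u ++ v.
Proof.
elim: u => [|a u IH] /=; first by rewrite eqxx.
by rewrite inE negb_or eq_sym => /andP[/negbTE-> /IH->].
Qed.

Lemma count_desc_min n (x : 'I_n) (s1 s2 : seq 'I_n) :
  pairwise (fun y z : 'I_n => y < z) (s1 ++ x :: s2) ->
  count (desc_min x) (permutations (s1 ++ s2)) = nwords (size s2) (size s1).
Proof.
have [m] := ubnP (size (s1 ++ s2)).
elim: m => // m IH in x s1 s2 *; rewrite ltnS => le.
have [/eqP|ne] := eqVneq (s1 ++ s2) [::].
  by rewrite -size_eq0 size_cat addn_eq0 => /andP[/nilP-> /nilP->].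
move=> pw.
have us : uniq (s1 ++ x :: s2).
  by apply: pairwise_uniq pw => y; rewrite ltnn.
have us12 : uniq (s1 ++ s2).
  by apply: subseq_uniq us; rewrite cat_subseq // subseq_cons.
rewrite count_permutations // big_cat /=.
(* Any letter of [s2] may come next; the one of index [i] has [s1] and the first [i] letters of [s2]
   below it. *)
have -> :
  \sum_(y <- s2) count (fun t => desc_min x (y :: t))
                   (permutations (rem y (s1 ++ s2)))
  = \sum_(i < size s2) nwords (size s2 - i.+1) (size s1 + i).
  rewrite (big_nth x) big_mkord; apply: eq_bigr => i _.
  set y := nth x s2 i; have E : s2 = take i s2 ++ y :: drop i.+1 s2.
    by rewrite -drop_nth ?cat_take_drop.
  have [E1 E2] : size (take i s2) = i /\ size (drop i.+1 s2) = size s2 - i.+1.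
    by rewrite size_drop size_takel // ltnW.
  have -> : size s1 + i = size (s1 ++ take i s2) by rewrite size_cat E1.
  rewrite -E2.
  move: (take i s2) (drop i.+1 s2) y E => p q y E {E1 E2}.
  rewrite {}E in le pw us us12 *.
  rewrite catA rem_cat_cons; last first.
    by move: us12; rewrite catA cat_uniq /= => /and3P[_ /norP[]].
  rewrite -(IH y); first last.
  - by apply: subseq_pairwise pw; rewrite -catA cat_subseq // subseq_cons.
  - by apply: leq_trans le; rewrite catA !size_cat /= addnS.
  apply: eq_count => t /=.
  suff -> : x < y by [].
  move: pw; rewrite pairwise_cat /= all_cat /=.
  by case/and4P=> _ _ /and3P[].
case: s1 => [|a s1] in ne pw us us12 le *.
  rewrite big_nil add0n /=; case: s2 ne {us us12 pw le} => // z s2 _.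
  by rewrite -nwords_rec0.
rewrite nwords_rec_pos addnC; congr (_ + _).
have a_min : all (fun z : 'I_n => a < z) (s1 ++ s2).
  by move: pw => /= /andP[]; rewrite !all_cat /= => /and3P[-> _ ->].
have ax : a < x by move: pw => /= /andP[]; rewrite !all_cat /= => /and3P[].
(* A step down to a letter of [s1] other than its minimum [a] is impossible: [a] would still have to
   occur among the remaining letters, all of which must exceed it. *)
rewrite big_cons big_seq big1 ?addn0 => [|y ys1]; last first.
  apply/eqP; rewrite -leqn0 leqNgt -has_count; apply/hasPn => t.
  rewrite mem_permutations => pt /=.
  have yx : y < x.
    move: pw; rewrite pairwise_cat allrel_consr => /andP[/andP[/allP yx _] _].
    by apply: yx; rewrite inE ys1 orbT.
  have ay : a < y by apply: (allP a_min); rewrite mem_cat ys1.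
  rewrite ltnNge (ltnW yx) /= -andbA negb_and; apply/orP; right.
  rewrite negb_and; apply/orP; left; apply/allPn; exists a.
    rewrite (perm_mem pt) /=; case: eqP => [ay'|_]; last exact: mem_head.
    by rewrite ay' ltnn in ay.
  by rewrite -leqNgt ltnW.
rewrite /= eqxx addnC -size_cat.
have [s0|s0] := eqVneq (s1 ++ s2) [::].
  apply/eqP; rewrite s0 -leqn0 leqNgt -has_count; apply/hasPn => t.
  by rewrite mem_permutations => /perm_nilP->; rewrite /= ltnNge ltnW.
have -> : (if size (s1 ++ s2) is c.+1 then gould c else 0)
    = nwords (size (s1 ++ s2)) (size (Nil 'I_n)).
  by case: (s1 ++ s2) s0.
rewrite -(IH a) //; last first.
  by apply: subseq_pairwise pw; rewrite /= eqxx cat_subseq // subseq_cons.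
apply: eq_in_count => t; rewrite mem_permutations => pt /=.
by rewrite (perm_all _ pt) a_min -size_eq0 (perm_size pt) size_eq0 s0 orbT.
Qed.

Lemma perm_one_line_rev n :
  perm_eq [seq rev (one_line pi) | pi <- enum 'S_n] (permutations (enum 'I_n)).
Proof.
have U : uniq [seq rev (one_line pi) | pi : 'S_n].
  rewrite map_inj_uniq ?enum_uniq // => pi rho /(can_inj revK) /eq_in_map E.
  by apply/permP => i; apply: E; rewrite mem_enum.
apply: uniq_perm (permutations_uniq _) _ => //.
(* Inclusion suffices: both lists are duplicate-free and have [n]! elements. *)
suff H : {subset [seq rev (one_line pi) | pi : 'S_n] <= permutations (enum 'I_n)}.
  case: (uniq_min_size U H) => //.
  rewrite size_permutations ?enum_uniq // size_enum_ord.
  by rewrite size_image card_Sn.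
move=> _ /mapP[pi _ ->].
rewrite mem_permutations perm_rev; apply: uniq_perm; rewrite ?enum_uniq //.
  by rewrite map_inj_uniq ?enum_uniq //; apply: perm_inj.
move=> i; rewrite mem_enum; apply/mapP.
by exists ((pi^-1)%g i); rewrite ?mem_enum ?permKV.
Qed.

Lemma count_good_word m :
  count good_word (permutations (enum 'I_m.+2)) = gould m.
Proof.
have := enum_ord_pairwise m.+2.
have := enum_uniq 'I_m.+2; rewrite enum_ordSl.
set s := map _ _ => us pw; rewrite count_permutations // big_cons /=.
have /andP[s_min _] := pw.
rewrite big_seq big1 ?addn0 => [|y ys].
  (* The reversed word starts with [ord0], leaving [m.+1] letters above and none below, and
     [nwords m.+1 0] is [gould m]. *)
  rewrite -[RHS](_ : nwords (size s) 0 = _); last by rewrite size_map size_enum_ord.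
  rewrite -(@count_desc_min _ ord0 [::] s) //.
  by apply: eq_in_count => t; rewrite mem_permutations => /perm_all->; rewrite s_min.
apply/eqP; rewrite -leqn0 leqNgt -has_count; apply/hasPn => t.
rewrite mem_permutations => pt; rewrite negb_and; apply/orP; left.
apply/allPn; exists ord0; last by rewrite -leqNgt.
rewrite (perm_mem pt); case: eqP => [y0|_]; last exact: mem_head.
by have := allP s_min _ ys; rewrite -y0.
Qed.

Theorem theorem6p6 (n : nat) (hn : 2 <= n) :
  #|[set pi : 'S_n | avoids pi pat_12_2to3 && avoids pi pat_1_1to1]|
  = gould (n - 2).
Proof.
case: n hn => [|[|m]] // hn; rewrite subn2 /= -count_good_word.
rewrite -(seq.permP (perm_one_line_rev m.+2)) count_map cardsE cardE.
rewrite {1}/enum_mem size_filter -enumT; apply: eq_count => pi /=.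
by rewrite -avoids_good_word.
Qed.
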